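(* Let $n\ge 0$ be a fixed integer, let $\alpha\in\mathbb{C}$ and $\phi\in\mathbb{R}$ be fixed, and write $x+i\lambda=re^{i\theta}$ with $r\ge 0$, $\theta\in[0,\pi]$ (so $x=r\cos\theta$, $\lambda=r\sin\theta$). Put $$\xi=\alpha+1-2\lambda\cos\phi-2x\sin\phi .$$ Then $$P_n^{(\lambda)}(x;\phi)=L_n^{(\alpha)}(\xi)+\mathcal{O}\left(r^{n-1}\right),\qquad r\to\infty,$$ uniformly with respect to $\theta\in[0,\pi]$.
   Context: The Meixner-Pollaczek polynomials $P_n^{(\lambda)}(x;\phi)$ are defined by the generating function $$\left(1-e^{i\phi}w\right)^{-\lambda+ix}\left(1-e^{-i\phi}w\right)^{-\lambda-ix}=\sum_{n=0}^\infty P_n^{(\lambda)}(x;\phi)\,w^n,\qquad |w|<1,$$ with powers taking the value $1$ at $w=0$. The Laguerre polynomials $L_n^{(\alpha)}(x)$ are defined, for $\alpha,x\in\mathbb{C}$, by $$(1-w)^{-\alpha-1}e^{-wx/(1-w)}=\sum_{n=0}^\infty L_n^{(\alpha)}(x)\,w^n,\qquad |w|<1.$$ *)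

(* Defs.v *)
From Stdlib Require Import Reals Lra.
From Coquelicot Require Import Coquelicot.
Open Scope R_scope.

Definition Cexp (z : C) : C :=
  (exp (Re z) * cos (Im z), exp (Re z) * sin (Im z)).

(* Principal argument, with values in (-PI, PI] for z <> 0. *)
Definition Carg (z : C) : R :=
  if Rle_dec 0 (Im z) then acos (Re z / Cmod z) else - acos (Re z / Cmod z).

Definition Clog (z : C) : C := (ln (Cmod z), Carg z).

(* Principal power z ^ a, meaningful for z <> 0.  For |u| <= 1 and |w| < 1 the
   base 1 - u w has positive real part, so on the disc |w| < 1 the function
   w |-> Cpower (1 - u w) a is the analytic branch with value 1 at w = 0. *)
Definition Cpower (z a : C) : C := Cexp (a * Clog z)%C.

(* [p n] is the coefficient P_n^(lam)(x; phi) of w^n. *)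
Definition is_meixner_pollaczek (lam x phi : R) (p : nat -> C) : Prop :=
  forall w : C, Cmod w < 1 ->
    is_pseries p w
      (Cpower (1 - Cexp (Ci * phi) * w) (- lam + Ci * x) *
       Cpower (1 - Cexp (- (Ci * phi)) * w) (- lam - Ci * x))%C.

(* [l n] is the coefficient L_n^(alpha)(x) of w^n. *)
Definition is_laguerre (alpha x : C) (l : nat -> C) : Prop :=
  forall w : C, Cmod w < 1 ->
    is_pseries l w
      (Cpower (1 - w) (- alpha - 1) * Cexp (- (w * x / (1 - w))))%C.

Lemma Carg_right_half_plane (z : C) : 0 < Re z -> Carg z = atan (Im z / Re z).
Proof.
destruct z as [x y]; unfold Carg, Cmod, Re, Im; simpl fst; simpl snd; intros hx.
set (m := sqrt (x ^ 2 + y ^ 2)).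
assert (hm : 0 < m) by (apply sqrt_lt_R0; nra).
assert (hm2 : m * m = x ^ 2 + y ^ 2) by (apply sqrt_sqrt; nra).
assert (hq : 0 < x / m) by (apply Rdiv_lt_0_compat; lra).
rewrite (acos_atan _ hq).
assert (hs : sqrt (1 - (x / m)²) = Rabs y / m).
{ replace (1 - (x / m)²) with ((Rabs y / m)²).
  - apply sqrt_Rsqr.
    apply Rmult_le_pos; [apply Rabs_pos | apply Rlt_le, Rinv_0_lt_compat, hm].
  - rewrite !Rsqr_div', <- (Rsqr_abs y); unfold Rsqr.
    rewrite hm2; field; nra. }
rewrite hs.
replace (Rabs y / m / (x / m)) with (Rabs y / x) by (field; lra).
destruct (Rle_dec 0 y) as [hy | hy].
- now rewrite Rabs_pos_eq.
- rewrite Rabs_left by lra.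
  rewrite <- atan_opp; f_equal; field; lra.
Qed.

Lemma Cpower_1_l (a : C) : Cpower 1 a = 1%C.
Proof.
unfold Cpower, Clog.
rewrite Carg_right_half_plane by (simpl; lra).
rewrite Cmod_1, ln_1; simpl.
replace (0 / 1) with 0 by field.
rewrite atan_0; unfold Cexp; simpl.
replace (fst a * 0 - snd a * 0) with 0 by ring.
replace (fst a * 0 + snd a * 0) with 0 by ring.
rewrite exp_0, cos_0, sin_0; unfold RtoC; f_equal; ring.
Qed.

(* Main.v *)
Require Import Defs.
From Stdlib Require Import Reals ZArith Lra Lia.
From Coquelicot Require Import Coquelicot.
Open Scope R_scope.

(** On real [t] both generating functions have the form [f = exp A] with
    [(1 + b t + t^2) A' = c0 + c1 t], so the linear equation
    [(1 + b t + t^2) f' = (c0 + c1 t) f] gives the three-term recurrence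
    [(k+2) p_{k+2} + b (k+1) p_{k+1} + k p_k = c0 p_{k+1} + c1 p_k].
    The choice of [xi] makes [c0 = 2 lam cos phi + 2 x sin phi] the same for both
    families.  Since [b = O(1)] and [c0, c1 = O(r)], induction gives
    [p_k = O(r^k)]; in the difference of the two recurrences the [c0]-terms combine
    to [c0 (p_{k+1} - l_{k+1})], and the other terms are of lower order, so
    [p_k - l_k = O(r^(k-1))]. *)

(** * Complex power series on the real axis *)

(** At a real point the powers of [w] are real, so a real-linear [h] commutes with every partial
    sum, and continuity of [h] at [l] carries this to the limit. *)
Lemma is_pseries_real_linear (h : C -> R) (p : nat -> C) (w : R) (l : C) :
  continuous h l ->
  (forall y z : C, h (y + z)%C = h y + h z) ->
  (forall (a : R) (z : C), h (RtoC a * z)%C = a * h z) ->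
  is_pseries p (RtoC w) l -> is_pseries (fun k => h (p k)) w (h l).
Proof.
intros hc hadd hscal H.
assert (hpow : forall k, @pow_n C_Ring (RtoC w) k = RtoC (pow_n w k)).
{ intros k; induction k as [|k IH]; [reflexivity|].
  simpl; rewrite IH; symmetry; apply RtoC_mult. }
assert (hsum : forall n,
  sum_n (fun k => scal (pow_n w k) (h (p k))) n =
  h (sum_n (fun k => @scal C_AbsRing C_NormedModule (pow_n (RtoC w : C_Ring) k) (p k)) n)).
{ intros n; induction n as [|n IH].
  - rewrite !sum_O, hpow; symmetry; apply hscal.
  - rewrite !sum_Sn, IH, hpow.
    etransitivity; [|symmetry; apply hadd].
    apply f_equal; symmetry; apply hscal. }
unfold is_pseries, is_series.
apply filterlim_ext with (2 := filterlim_comp _ _ _ _ _ _ _ _ H hc).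
intros n; symmetry; apply hsum.
Qed.

Lemma is_pseries_Re (p : nat -> C) (w : R) (l : C) :
  is_pseries p (RtoC w) l -> is_pseries (fun k => Re (p k)) w (Re l).
Proof.
apply (is_pseries_real_linear Re).
- destruct l; apply (@continuous_fst R_UniformSpace R_UniformSpace).
- reflexivity.
- intros a [z1 z2]; cbv [Re Im Cmult RtoC fst snd]; ring.
Qed.

Lemma is_pseries_Im (p : nat -> C) (w : R) (l : C) :
  is_pseries p (RtoC w) l -> is_pseries (fun k => Im (p k)) w (Im l).
Proof.
apply (is_pseries_real_linear Im).
- destruct l; apply (@continuous_snd R_UniformSpace R_UniformSpace).
- reflexivity.
- intros a [z1 z2]; cbv [Re Im Cmult RtoC fst snd]; ring.
Qed.

(** * Real power series on (-1, 1): radius, uniqueness, differentiation *)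

(** Convergence at [r] makes the terms there tend to 0, which is impossible outside the disc of
    convergence; so the radius is at least [Rabs r]. *)
Lemma Rabs_lt_CV_radius (a : nat -> R) (w r : R) :
  ex_pseries a r -> Rabs w < Rabs r -> Rbar_lt (Rabs w) (CV_radius a).
Proof.
intros hr hw.
apply Rbar_lt_le_trans with (Rabs r); [exact hw|].
apply Rbar_not_lt_le; intros hlt.
apply (CV_disk_outside a r hlt), ex_series_lim_0.
destruct hr as [l hl]; exists l.
now apply is_pseries_R.
Qed.

Lemma Rabs_lt_CV_radius_unit_disc (a : nat -> R) (F : R -> R) (w : R) :
  (forall t, Rabs t < 1 -> is_pseries a t (F t)) ->
  Rabs w < 1 -> Rbar_lt (Rabs w) (CV_radius a).
Proof.
intros H hw.
pose proof (Rabs_pos w).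
(* The midpoint of [Rabs w] and 1 is a point of convergence strictly beyond [Rabs w]. *)
assert (e : Rabs ((1 + Rabs w) / 2) = (1 + Rabs w) / 2)
  by (apply Rabs_pos_eq; lra).
apply Rabs_lt_CV_radius with ((1 + Rabs w) / 2); [|lra].
exists (F ((1 + Rabs w) / 2)); apply H; lra.
Qed.

Lemma locally_unit_disc (w : R) :
  Rabs w < 1 -> locally w (fun t => Rabs t < 1).
Proof.
intros hw.
assert (he : 0 < 1 - Rabs w) by lra.
exists (mkposreal _ he); intros t ht.
change (Rabs (t - w) < 1 - Rabs w) in ht.
change (Rabs t < 1); revert ht hw; unfold Rabs.
repeat destruct Rcase_abs; intros; lra.
Qed.

Lemma is_pseries_coeff_eq (a b : nat -> R) (F : R -> R) :
  (forall t, Rabs t < 1 -> is_pseries a t (F t)) ->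
  (forall t, Rabs t < 1 -> is_pseries b t (F t)) ->
  forall n, a n = b n.
Proof.
intros Ha Hb n.
assert (h0 : Rabs 0 < 1) by (rewrite Rabs_R0; lra).
apply PSeries_ext_recip.
- rewrite <- Rabs_R0; now apply Rabs_lt_CV_radius_unit_disc with F.
- rewrite <- Rabs_R0; now apply Rabs_lt_CV_radius_unit_disc with F.
- generalize (locally_unit_disc 0 h0); apply filter_imp; intros t ht.
  now rewrite (is_pseries_unique _ _ _ (Ha t ht)), (is_pseries_unique _ _ _ (Hb t ht)).
Qed.

Lemma is_pseries_is_derive (a : nat -> R) (F : R -> R) (w d : R) :
  (forall t, Rabs t < 1 -> is_pseries a t (F t)) ->
  Rabs w < 1 -> is_derive F w d -> is_pseries (PS_derive a) w d.
Proof.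
intros Ha hw hd.
replace d with (Derive (PSeries a) w).
{ apply is_pseries_derive; now apply Rabs_lt_CV_radius_unit_disc with F. }
apply is_derive_unique.
apply is_derive_ext_loc with (2 := hd).
generalize (locally_unit_disc w hw); apply filter_imp; intros t ht.
symmetry; now apply is_pseries_unique, Ha.
Qed.

(** * From the differential equation to the recurrence *)

(** Both sides of the equation are expanded and their coefficients compared. The [G] term is there
    because the real and imaginary parts of a complex linear equation are coupled. *)
Lemma is_pseries_ode_coeff (u v : nat -> R) (F G dF : R -> R) (b a0 a1 d0 d1 : R) :
  (forall t, Rabs t < 1 -> is_pseries u t (F t)) ->
  (forall t, Rabs t < 1 -> is_pseries v t (G t)) ->
  (forall t, Rabs t < 1 -> is_derive F t (dF t)) ->
  (forall t, Rabs t < 1 ->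
    (1 + b * t + t ^ 2) * dF t = (a0 + a1 * t) * F t + (d0 + d1 * t) * G t) ->
  u 1%nat = a0 * u 0%nat + d0 * v 0%nat /\
  forall k, INR (S (S k)) * u (S (S k)) + b * INR (S k) * u (S k) + INR k * u k =
    a0 * u (S k) + a1 * u k + (d0 * v (S k) + d1 * v k).
Proof.
intros Hu Hv HF Hode.
set (lhs := PS_plus (PS_derive u)
  (PS_plus (PS_scal b (PS_incr_1 (PS_derive u)))
           (PS_incr_1 (PS_incr_1 (PS_derive u))))).
set (rhs := PS_plus (PS_plus (PS_scal a0 u) (PS_scal a1 (PS_incr_1 u)))
  (PS_plus (PS_scal d0 v) (PS_scal d1 (PS_incr_1 v)))).
assert (E : forall n, lhs n = rhs n).
{ apply is_pseries_coeff_eq with (fun t => (1 + b * t + t ^ 2) * dF t).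
  - intros t ht.
    pose proof (is_pseries_is_derive u F t _ Hu ht (HF t ht)) as D.
    replace ((1 + b * t + t ^ 2) * dF t)
      with (dF t + (b * (t * dF t) + t * (t * dF t))) by ring.
    apply (is_pseries_plus (V := R_NormedModule)); [exact D|].
    apply (is_pseries_plus (V := R_NormedModule)).
    + apply (is_pseries_scal (V := R_NormedModule)); [apply Rmult_comm|].
      now apply (is_pseries_incr_1 (V := R_NormedModule)).
    + now do 2 apply (is_pseries_incr_1 (V := R_NormedModule)).
  - intros t ht; rewrite (Hode t ht).
    replace ((a0 + a1 * t) * F t + (d0 + d1 * t) * G t) with
      (a0 * F t + a1 * (t * F t) + (d0 * G t + d1 * (t * G t))) by ring.
    apply (is_pseries_plus (V := R_NormedModule));
      apply (is_pseries_plus (V := R_NormedModule));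
      apply (is_pseries_scal (V := R_NormedModule)); try apply Rmult_comm;
      auto; now apply (is_pseries_incr_1 (V := R_NormedModule)); auto. }
split.
- specialize (E 0%nat).
  change (1 * u 1%nat + (b * 0 + 0) =
          a0 * u 0%nat + a1 * 0 + (d0 * v 0%nat + d1 * 0)) in E.
  lra.
(* The doubly shifted series has coefficient 0 at index 1, so that index is computed apart from the
   later ones. *)
- intros [|k].
  + specialize (E 1%nat).
    change ((1 + 1) * u 2%nat + (b * (1 * u 1%nat) + 0) =
      a0 * u 1%nat + a1 * u 0%nat + (d0 * v 1%nat + d1 * v 0%nat)) in E.
    simpl; lra.
  + specialize (E (S (S k))).
    change (INR (S (S (S k))) * u (S (S (S k))) + (b * (INR (S (S k)) * u (S (S k)))
       + INR (S k) * u (S k)) =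
       a0 * u (S (S k)) + a1 * u (S k) + (d0 * v (S (S k)) + d1 * v (S k))) in E.
    lra.
Qed.

(** The value of [p 1] is the recurrence at k = -1 with p_{-1} = 0. *)
Definition three_term_recurrence (b : R) (c0 c1 : C) (p : nat -> C) : Prop :=
  p 0%nat = 1%C /\ p 1%nat = c0 /\
  forall k, (RtoC (INR (S (S k))) * p (S (S k))
             + RtoC (b * INR (S k)) * p (S k) + RtoC (INR k) * p k
             = c0 * p (S k) + c1 * p k)%C.

(* [f = Cexp (A, B)] satisfies [(1 + b t + t^2) f' = (c0 + c1 t) f]. *)
Lemma three_term_exp (p : nat -> C) (A B dA dB : R -> R) (b : R) (c0 c1 : C) :
  (forall t, Rabs t < 1 -> is_pseries p (RtoC t) (Cexp (A t, B t))) ->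
  A 0 = 0 -> B 0 = 0 ->
  (forall t, Rabs t < 1 -> is_derive A t (dA t)) ->
  (forall t, Rabs t < 1 -> is_derive B t (dB t)) ->
  (forall t, Rabs t < 1 -> (1 + b * t + t ^ 2) * dA t = Re c0 + Re c1 * t) ->
  (forall t, Rabs t < 1 -> (1 + b * t + t ^ 2) * dB t = Im c0 + Im c1 * t) ->
  three_term_recurrence b c0 c1 p.
Proof.
intros Hp A0 B0 HA HB HdA HdB.
set (F := fun t => exp (A t) * cos (B t)).
set (G := fun t => exp (A t) * sin (B t)).
assert (HF : forall t, Rabs t < 1 -> is_pseries (fun k => Re (p k)) t (F t))
  by (intros t ht; exact (is_pseries_Re _ _ _ (Hp t ht))).
assert (HG : forall t, Rabs t < 1 -> is_pseries (fun k => Im (p k)) t (G t))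
  by (intros t ht; exact (is_pseries_Im _ _ _ (Hp t ht))).
assert (P0 : p 0%nat = 1%C).
{ assert (h0 : Rabs 0 < 1) by (rewrite Rabs_R0; lra).
  pose proof (is_pseries_unique _ _ _ (HF 0 h0)) as hF.
  pose proof (is_pseries_unique _ _ _ (HG 0 h0)) as hG.
  rewrite PSeries_0 in hF, hG.
  unfold F, G in hF, hG.
  rewrite A0, B0, exp_0, cos_0 in hF; rewrite A0, B0, exp_0, sin_0 in hG.
  destruct (p 0%nat) as [y z]; simpl in hF, hG.
  unfold RtoC; f_equal; lra. }
(* Real part: F' = A' F - B' G, hence the coupling coefficients [- Im c0] and [- Im c1]. *)
destruct (is_pseries_ode_coeff _ _ F G (fun t => dA t * F t - dB t * G t) b
  (Re c0) (Re c1) (- Im c0) (- Im c1) HF HG) as [F1 FS].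
{ intros t ht; unfold F, G.
  pose proof (HA t ht) as he; pose proof (HB t ht) as hs.
  auto_derive.
  - repeat split; eexists; eassumption.
  - rewrite (is_derive_unique _ _ _ he : Derive (fun x : R => A x) t = _),
      (is_derive_unique _ _ _ hs : Derive (fun x : R => B x) t = _); ring. }
{ intros t ht.
  replace ((1 + b * t + t ^ 2) * (dA t * F t - dB t * G t)) with
    ((1 + b * t + t ^ 2) * dA t * F t - (1 + b * t + t ^ 2) * dB t * G t) by ring.
  rewrite (HdA t ht), (HdB t ht); ring. }
(* Imaginary part: G' = A' G + B' F. *)
destruct (is_pseries_ode_coeff _ _ G F (fun t => dA t * G t + dB t * F t) b
  (Re c0) (Re c1) (Im c0) (Im c1) HG HF) as [G1 GS].
{ intros t ht; unfold F, G.
  pose proof (HA t ht) as he; pose proof (HB t ht) as hs.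
  auto_derive.
  - repeat split; eexists; eassumption.
  - rewrite (is_derive_unique _ _ _ he : Derive (fun x : R => A x) t = _),
      (is_derive_unique _ _ _ hs : Derive (fun x : R => B x) t = _); ring. }
{ intros t ht.
  replace ((1 + b * t + t ^ 2) * (dA t * G t + dB t * F t)) with
    ((1 + b * t + t ^ 2) * dA t * G t + (1 + b * t + t ^ 2) * dB t * F t) by ring.
  rewrite (HdA t ht), (HdB t ht); ring. }
repeat split.
- exact P0.
- rewrite P0 in F1, G1.
  destruct (p 1%nat), c0; simpl in *; f_equal; lra.
- intros k; specialize (FS k); specialize (GS k).
  destruct (p (S (S k))), (p (S k)), (p k), c0, c1.
  cbv [Cplus Cmult RtoC Re Im fst snd] in *; f_equal; lra.
Qed.

(** * Recurrences of the two polynomial families *)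

Lemma Cexp_plus (y z : C) : Cexp (y + z)%C = (Cexp y * Cexp z)%C.
Proof.
destruct y as [y1 y2], z as [z1 z2].
cbv [Cexp Cplus Cmult Re Im fst snd].
rewrite exp_plus, cos_plus, sin_plus; f_equal; ring.
Qed.

Lemma Cexp_Ci (phi : R) : Cexp (Ci * phi)%C = (cos phi, sin phi).
Proof.
cbv [Cexp Ci Cmult RtoC Re Im fst snd].
replace (0 * phi - 1 * 0) with 0 by ring.
replace (0 * 0 + 1 * phi) with phi by ring.
rewrite exp_0; f_equal; ring.
Qed.

Lemma Cexp_opp_Ci (phi : R) : Cexp (- (Ci * phi))%C = (cos phi, - sin phi).
Proof.
replace (- (Ci * phi))%C with (Ci * RtoC (- phi))%C
  by (rewrite RtoC_opp; ring).
now rewrite Cexp_Ci, cos_neg, sin_neg.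
Qed.

(** This is the real part of both Meixner-Pollaczek bases at real [t]; its positivity permits the
    arctangent formula for their arguments. *)
Lemma cos_disc_pos (phi t : R) : Rabs t < 1 -> 0 < 1 - cos phi * t.
Proof.
intros ht; pose proof (COS_bound phi); apply Rabs_def2 in ht.
destruct (Rle_dec 0 t); nra.
Qed.

(** For real [t] the two bases are conjugate, with common modulus [sqrt (D t)] and opposite
    arguments. The imaginary parts of the exponents cancel, so [B] is 0 and the generating function
    is the exponential of a real function. *)
Lemma meixner_pollaczek_three_term (lam x phi : R) (p : nat -> C) :
  is_meixner_pollaczek lam x phi p ->
  three_term_recurrence (- 2 * cos phi)
    (RtoC (2 * lam * cos phi + 2 * x * sin phi)) (RtoC (- 2 * lam)) p.
Proof.
intros H.
set (c := cos phi); set (s := sin phi).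
assert (hcs : s ^ 2 + c ^ 2 = 1)
  by (pose proof (sin2_cos2 phi) as h; unfold Rsqr in h; subst c s; lra).
set (D := fun t => 1 - 2 * c * t + t ^ 2).
assert (hD : forall t, Rabs t < 1 -> 0 < D t).
(* [D t] is (1 - c t)^2 + (s t)^2. *)
{ intros t ht; pose proof (cos_disc_pos phi t ht) as h; fold c in h.
  unfold D; nra. }
apply three_term_exp with
  (A := fun t => - 2 * lam * ln (sqrt (D t)) + 2 * x * atan (s * t / (1 - c * t)))
  (B := fun t => 0)
  (dA := fun t => (2 * lam * c + 2 * x * s - 2 * lam * t) / D t)
  (dB := fun t => 0).
- intros t ht.
  pose proof (cos_disc_pos phi t ht) as h; fold c in h.
  assert (ht' : Cmod (RtoC t) < 1) by (now rewrite Cmod_R).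
  specialize (H _ ht').
  rewrite Cexp_Ci, Cexp_opp_Ci in H; fold c s in H.
  unfold Cpower in H; rewrite <- Cexp_plus in H.
  replace (_, 0) with
    ((- lam + Ci * x) * Clog (1 - (c, s) * t) + (- lam - Ci * x) * Clog (1 - (c, (- s)%R) * t))%C;
    [exact H|].
  assert (e1 : Clog (1 - (c, s) * t)%C = (ln (sqrt (D t)), - atan (s * t / (1 - c * t)))).
  { unfold Clog; rewrite Carg_right_half_plane by (simpl; lra).
    unfold Cmod; simpl; f_equal.
    - do 2 f_equal; unfold D; nra.
    - rewrite <- atan_opp; f_equal; field; lra. }
  assert (e2 : Clog (1 - (c, (- s)%R) * t)%C = (ln (sqrt (D t)), atan (s * t / (1 - c * t)))).
  { unfold Clog; rewrite Carg_right_half_plane by (simpl; lra).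
    unfold Cmod; simpl; f_equal.
    - do 2 f_equal; unfold D; nra.
    - f_equal; field; lra. }
  rewrite e1, e2.
  cbv [Cplus Cminus Copp Cmult Ci RtoC fst snd]; f_equal; ring.
- unfold D; replace (1 - 2 * c * 0 + 0 ^ 2) with 1 by ring.
  rewrite sqrt_1, ln_1; replace (s * 0 / (1 - c * 0)) with 0 by field.
  rewrite atan_0; ring.
- reflexivity.
- intros t ht; specialize (hD t ht).
  pose proof (cos_disc_pos phi t ht) as h; fold c in h.
  assert (hs : 0 < sqrt (D t)) by now apply sqrt_lt_R0.
  assert (e : sqrt (D t) * sqrt (D t) = D t) by (apply sqrt_sqrt; lra).
  unfold D in *; auto_derive.
  + replace (1 + - (2 * c * t) + t * (t * 1)) with (1 - 2 * c * t + t ^ 2) by ring.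
    repeat split; lra.
  + replace (1 + - (2 * c * t) + t * (t * 1)) with (1 - 2 * c * t + t ^ 2) by ring.
    set (q := sqrt (1 - 2 * c * t + t ^ 2)) in *.
    (* The denominator from the derivative of the arctangent equals [D t / (1 - c * t) ^ 2]. *)
    replace (1 + s * t * / (1 + - (c * t)) * (s * t * / (1 + - (c * t)) * 1)) with
      (q * q / (1 - c * t) ^ 2).
    2:{ rewrite e; field_simplify_eq; [|lra].
        replace (s ^ 2) with (1 - c ^ 2) by lra; ring. }
    rewrite <- e; field; lra.
- intros t _; apply (@is_derive_const R_AbsRing R_NormedModule).
- intros t ht; specialize (hD t ht); simpl; fold c; fold s.
  unfold D in *; field; lra.
- intros; simpl; ring.
Qed.

(** The logarithmic derivative is (alpha + 1)/(1 - t) - xi/(1 - t)^2; multiplying by (1 - t)^2 = 1 -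
    2t + t^2 gives [b], [c0] and [c1]. *)
Lemma laguerre_three_term (alpha xi : C) (l : nat -> C) :
  is_laguerre alpha xi l ->
  three_term_recurrence (- 2) (alpha + 1 - xi)%C (- (alpha + 1))%C l.
Proof.
destruct alpha as [a1 a2], xi as [x1 x2]; intros H.
apply three_term_exp with
  (A := fun t => (- a1 - 1) * ln (1 - t) - t * x1 / (1 - t))
  (B := fun t => - a2 * ln (1 - t) - t * x2 / (1 - t))
  (dA := fun t => (a1 + 1) / (1 - t) - x1 / (1 - t) ^ 2)
  (dB := fun t => a2 / (1 - t) - x2 / (1 - t) ^ 2).
- intros t ht.
  assert (ht' : Cmod (RtoC t) < 1) by (now rewrite Cmod_R).
  specialize (H _ ht').
  apply Rabs_def2 in ht.
  unfold Cpower in H; rewrite <- Cexp_plus in H.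
  replace (_, _) with
    ((- (a1, a2) - 1) * Clog (1 - t) + - (t * (x1, x2) / (1 - t)))%C;
    [exact H|].
  assert (e : Clog (1 - t)%C = RtoC (ln (1 - t))).
  { unfold Clog; rewrite Carg_right_half_plane by (simpl; lra).
    rewrite <- RtoC_minus, Cmod_R, Rabs_pos_eq by lra.
    simpl; unfold RtoC; f_equal.
    replace (0 / (1 - t)) with 0 by (field; lra); apply atan_0. }
  rewrite e, <- RtoC_minus; unfold Cdiv; rewrite <- RtoC_inv by lra.
  cbv [Cplus Cminus Copp Cmult RtoC fst snd]; f_equal; field; lra.
- rewrite Rminus_0_r, ln_1; field.
- rewrite Rminus_0_r, ln_1; field.
- intros t ht; apply Rabs_def2 in ht.
  auto_derive; [repeat split; lra | field; lra].
- intros t ht; apply Rabs_def2 in ht.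
  auto_derive; [repeat split; lra | field; lra].
- intros t ht; apply Rabs_def2 in ht; simpl; field; lra.
- intros t ht; apply Rabs_def2 in ht; simpl; field; lra.
Qed.

(** * Elementary modulus estimates *)

Lemma Cmod_mult_le (y z : C) (a b : R) :
  Cmod y <= a -> Cmod z <= b -> Cmod (y * z)%C <= a * b.
Proof.
intros; rewrite Cmod_mult; apply Rmult_le_compat; auto using Cmod_ge_0.
Qed.

Lemma Cmod_plus_le (y z : C) (a b : R) :
  Cmod y <= a -> Cmod z <= b -> Cmod (y + z)%C <= a + b.
Proof.
intros; eapply Rle_trans; [apply Cmod_triangle | lra].
Qed.

Lemma Cmod_minus_le (y z : C) (a b : R) :
  Cmod y <= a -> Cmod z <= b -> Cmod (y - z)%C <= a + b.
Proof.
intros; apply Cmod_plus_le; now rewrite ?Cmod_opp.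
Qed.

Lemma Cmod_RtoC_le (a b : R) : Rabs a <= b -> Cmod (RtoC a) <= b.
Proof.
now rewrite Cmod_R.
Qed.

Lemma Cmod_INR_le (k : nat) : Cmod (RtoC (INR k)) <= INR k.
Proof.
apply Cmod_RtoC_le; rewrite Rabs_pos_eq; [lra | apply pos_INR].
Qed.

(** Lets the leading factor k + 2 of the recurrence be dropped instead of divided out. *)
Lemma Cmod_le_INR_mult (k : nat) (z : C) :
  Cmod z <= Cmod (RtoC (INR (S k)) * z)%C.
Proof.
rewrite Cmod_mult, Cmod_R, Rabs_pos_eq by apply pos_INR.
pose proof (Cmod_ge_0 z); pose proof (pos_INR k); rewrite S_INR; nra.
Qed.

Lemma scal_pow_le_S (r a : R) (k : nat) :
  1 <= r -> 0 <= a -> a * r ^ k <= a * r ^ S k.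
Proof.
intros hr ha; apply Rmult_le_compat_l; [exact ha|].
apply Rle_pow; [exact hr | lia].
Qed.

(** * Growth of solutions and of their differences *)

(** [B] is chosen before the coefficients, the solution and [r], which is the source of the
    uniformity in theta. *)
Lemma three_term_bound (M : R) (n : nat) : 0 <= M ->
  exists B, 0 <= B /\ forall b c0 c1 p r, 1 <= r ->
    Rabs b <= M -> Cmod c0 <= M * r -> Cmod c1 <= M * r ->
    three_term_recurrence b c0 c1 p -> Cmod (p n) <= B * r ^ n.
Proof.
intros hM.
set (Q := fun n => exists B, 0 <= B /\ forall b c0 c1 p r, 1 <= r ->
    Rabs b <= M -> Cmod c0 <= M * r -> Cmod c1 <= M * r ->
    three_term_recurrence b c0 c1 p -> Cmod (p n) <= B * r ^ n).
(* The recurrence has order two, so the induction carries two consecutive indices. *)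
enough (H : Q n /\ Q (S n)) by apply H.
induction n as [|k [[B0 [hB0 IH0]] [B1 [hB1 IH1]]]].
- split.
  + exists 1; split; [lra|].
    intros b c0 c1 p r _ _ _ _ [-> _]; rewrite Cmod_1; simpl; lra.
  + exists M; split; [exact hM|].
    intros b c0 c1 p r _ _ h _ [_ [-> _]]; simpl; lra.
- split; [now exists B1|].
  pose proof (pos_INR k) as hk; pose proof (pos_INR (S k)) as hk1.
  (* One summand per term of the recurrence; powers of [r] below k + 2 are absorbed since
     [1 <= r]. *)
  exists (M * B1 + M * B0 + M * INR (S k) * B1 + INR k * B0); split.
  { repeat apply Rplus_le_le_0_compat; repeat apply Rmult_le_pos; auto. }
  intros b c0 c1 p r hr hb h0 h1 Hp.
  specialize (IH0 _ _ _ _ _ hr hb h0 h1 Hp).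
  specialize (IH1 _ _ _ _ _ hr hb h0 h1 Hp).
  destruct Hp as [_ [_ Hp]]; specialize (Hp k).
  eapply Rle_trans; [apply (Cmod_le_INR_mult (S k))|].
  replace (RtoC (INR (S (S k))) * p (S (S k)))%C with
    (c0 * p (S k) + c1 * p k - RtoC (b * INR (S k)) * p (S k) - RtoC (INR k) * p k)%C
    by (rewrite <- Hp; ring).
  apply Rle_trans with
    (M * r * (B1 * r ^ S k) + M * r * (B0 * r ^ k)
     + M * INR (S k) * (B1 * r ^ S k) + INR k * (B0 * r ^ k)).
  { apply Cmod_minus_le; [apply Cmod_minus_le; [apply Cmod_plus_le|]|];
      apply Cmod_mult_le; auto using Cmod_INR_le.
    apply Cmod_RtoC_le; rewrite Rabs_mult, (Rabs_pos_eq _ hk1).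
    now apply Rmult_le_compat_r. }
  assert (t1 := scal_pow_le_S r (M * B0) (S k) hr ltac:(now apply Rmult_le_pos)).
  assert (t2 := scal_pow_le_S r (M * INR (S k) * B1) (S k) hr
    ltac:(now repeat apply Rmult_le_pos)).
  assert (t3 := scal_pow_le_S r (INR k * B0) k hr ltac:(now apply Rmult_le_pos)).
  assert (t4 := scal_pow_le_S r (INR k * B0) (S k) hr ltac:(now apply Rmult_le_pos)).
  simpl pow in *; lra.
Qed.

(** Both recurrences share [c0], so the two solutions agree at indices 0 and 1. The factor [r] on
    the left replaces the exponent n - 1, which would be negative at n = 0. *)
Lemma three_term_diff_bound (M : R) (n : nat) : 0 <= M ->
  exists K, 0 <= K /\ forall b b' c0 c1 c1' p l r, 1 <= r ->
    Rabs b <= M -> Rabs b' <= M -> Cmod c0 <= M * r ->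
    Cmod c1 <= M * r -> Cmod c1' <= M * r ->
    three_term_recurrence b c0 c1 p -> three_term_recurrence b' c0 c1' l ->
    r * Cmod (p n - l n)%C <= K * r ^ n.
Proof.
intros hM.
set (Q := fun n => exists K, 0 <= K /\ forall b b' c0 c1 c1' p l r, 1 <= r ->
    Rabs b <= M -> Rabs b' <= M -> Cmod c0 <= M * r ->
    Cmod c1 <= M * r -> Cmod c1' <= M * r ->
    three_term_recurrence b c0 c1 p -> three_term_recurrence b' c0 c1' l ->
    r * Cmod (p n - l n)%C <= K * r ^ n).
enough (H : Q n /\ Q (S n)) by apply H.
induction n as [|k [_ [K [hK IH]]]].
- split; exists 0; (split; [lra|]);
    intros b b' c0 c1 c1' p l r _ _ _ _ _ _ [p0 [p1 _]] [l0 [l1 _]].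
  + rewrite p0, l0; replace (1 - 1)%C with (RtoC 0) by ring; rewrite Cmod_0; lra.
  + rewrite p1, l1; replace (c0 - c0)%C with (RtoC 0) by ring; rewrite Cmod_0; lra.
- split; [now exists K|].
  pose proof (pos_INR k) as hk; pose proof (pos_INR (S k)) as hk1.
  destruct (three_term_bound M k hM) as [B0 [hB0 H0]].
  destruct (three_term_bound M (S k) hM) as [B1 [hB1 H1]].
  (* [M * K] comes from the shared [c0] term; the remaining terms are bounded separately for each
     solution, hence the factors 2. *)
  exists (M * K + 2 * (M * B0) + 2 * (M * INR (S k) * B1) + 2 * (INR k * B0)); split.
  { repeat apply Rplus_le_le_0_compat; repeat apply Rmult_le_pos; auto; lra. }
  intros b b' c0 c1 c1' p l r hr hb hb' h0 h1 h1' Hp Hl.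
  specialize (IH _ _ _ _ _ _ _ _ hr hb hb' h0 h1 h1' Hp Hl).
  pose proof (H0 _ _ _ _ _ hr hb h0 h1 Hp) as Hp0.
  pose proof (H1 _ _ _ _ _ hr hb h0 h1 Hp) as Hp1.
  pose proof (H0 _ _ _ _ _ hr hb' h0 h1' Hl) as Hl0.
  pose proof (H1 _ _ _ _ _ hr hb' h0 h1' Hl) as Hl1.
  destruct Hp as [_ [_ Hp]]; specialize (Hp k).
  destruct Hl as [_ [_ Hl]]; specialize (Hl k).
  set (d := Cmod (p (S k) - l (S k))%C) in *.
  assert (hstep : Cmod (p (S (S k)) - l (S (S k)))%C <=
    M * r * d
     + (M * r * (B0 * r ^ k) + M * INR (S k) * (B1 * r ^ S k) + INR k * (B0 * r ^ k))
     + (M * r * (B0 * r ^ k) + M * INR (S k) * (B1 * r ^ S k) + INR k * (B0 * r ^ k))).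
  { eapply Rle_trans; [apply (Cmod_le_INR_mult (S k))|].
    replace (RtoC (INR (S (S k))) * (p (S (S k)) - l (S (S k))))%C with
      (c0 * (p (S k) - l (S k))
       + (c1 * p k - RtoC (b * INR (S k)) * p (S k) - RtoC (INR k) * p k)
       - (c1' * l k - RtoC (b' * INR (S k)) * l (S k) - RtoC (INR k) * l k))%C.
    2:{ transitivity ((c0 * p (S k) + c1 * p k) - (c0 * l (S k) + c1' * l k)
          - RtoC (b * INR (S k)) * p (S k) - RtoC (INR k) * p k
          + RtoC (b' * INR (S k)) * l (S k) + RtoC (INR k) * l k)%C; [ring|].
        rewrite <- Hp, <- Hl; ring. }
    apply Cmod_minus_le; [apply Cmod_plus_le; [|apply Cmod_minus_le; [apply Cmod_minus_le|]]
      |apply Cmod_minus_le; [apply Cmod_minus_le|]];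
      apply Cmod_mult_le; auto using Cmod_INR_le, Rle_refl;
      apply Cmod_RtoC_le; rewrite Rabs_mult, (Rabs_pos_eq _ hk1);
      now apply Rmult_le_compat_r. }
  (* After [hstep] is multiplied by [r], every term has order r^(k+2) except the [INR k * B0] ones,
     which are one power lower and are raised by [t3]. *)
  assert (t0 : M * r * (r * d) <= M * r * (K * r ^ S k))
    by (apply Rmult_le_compat_l; [apply Rmult_le_pos; lra | exact IH]).
  assert (t3 := scal_pow_le_S r (INR k * B0) (S k) hr ltac:(now apply Rmult_le_pos)).
  assert (t5 := Rmult_le_compat_l r _ _ ltac:(lra) hstep).
  simpl pow in *; lra.
Qed.

(** * Uniform comparison of the two families *)

Theorem mainTheorem1
  (P : nat -> R -> R -> R -> C)
  (L : nat -> C -> C -> C)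
  (HP : forall lam x phi : R,
      is_meixner_pollaczek lam x phi (fun n => P n lam x phi))
  (HL : forall alpha x : C, is_laguerre alpha x (fun n => L n alpha x))
  (n : nat) (alpha : C) (phi : R) :
  exists K r0 : R, 0 < r0 /\
    forall x lam r theta : R,
      r0 <= r -> 0 <= theta <= PI ->
      x = r * cos theta -> lam = r * sin theta ->
      let xi : C :=
        (alpha + 1 - RtoC (2 * lam * cos phi) - RtoC (2 * x * sin phi))%C in
      Cmod (P n lam x phi - L n alpha xi)%C
        <= K * powerRZ r (Z.of_nat n - 1).
Proof.
assert (hA := Cmod_ge_0 (alpha + 1)%C).
(* The 4 covers both values of [b], the common [c0] (at most 2r + 2r) and [- 2 * lam]; the other
   summand covers the Laguerre [c1], as [1 <= r]. *)
set (M := 4 + Cmod (alpha + 1)%C).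
assert (hM : 0 <= M) by (unfold M; lra).
destruct (three_term_diff_bound M n hM) as [K [_ HK]].
exists K, 1; split; [lra|].
intros x lam r theta hr _ hx hl xi.
assert (hprod : forall y z, Rabs y <= 1 -> Rabs z <= 1 -> Rabs (2 * (r * y) * z) <= 2 * r).
{ intros y z hy hz; rewrite !Rabs_mult, (Rabs_pos_eq 2), (Rabs_pos_eq r) by lra.
  pose proof (Rabs_pos y); pose proof (Rabs_pos z).
  assert (Rabs y * Rabs z <= 1 * 1) by now apply Rmult_le_compat.
  nra. }
assert (hcos : forall y, Rabs (cos y) <= 1)
  by (intros y; apply Rabs_le; pose proof (COS_bound y); lra).
assert (hsin : forall y, Rabs (sin y) <= 1)
  by (intros y; apply Rabs_le; pose proof (SIN_bound y); lra).
assert (hMr : 4 * r + Cmod (alpha + 1)%C <= M * r) by (unfold M; nra).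
pose proof (laguerre_three_term _ _ _ (HL alpha xi)) as Hlag.
(* The choice of [xi] gives the Laguerre recurrence the Meixner-Pollaczek [c0]. *)
replace (alpha + 1 - xi)%C with (RtoC (2 * lam * cos phi + 2 * x * sin phi)) in Hlag
  by (unfold xi; rewrite RtoC_plus; ring).
assert (H : r * Cmod (P n lam x phi - L n alpha xi)%C <= K * r ^ n).
{ apply (HK _ _ _ _ _ (fun n => P n lam x phi) (fun n => L n alpha xi) r hr)
    with (6 := meixner_pollaczek_three_term _ _ _ _ (HP lam x phi)) (7 := Hlag).
  - rewrite Rabs_mult, Rabs_left by lra; specialize (hcos phi); unfold M; lra.
  - rewrite Rabs_left by lra; unfold M; lra.
  - apply Cmod_RtoC_le.
    eapply Rle_trans; [apply Rabs_triang|]; subst x lam.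
    pose proof (hprod _ _ (hsin theta) (hcos phi)).
    pose proof (hprod _ _ (hcos theta) (hsin phi)); lra.
  - apply Cmod_RtoC_le; subst lam.
    replace (- 2 * (r * sin theta)) with (2 * (r * sin theta) * - 1) by ring.
    assert (h1 : Rabs (- 1) <= 1) by (rewrite Rabs_left; lra).
    pose proof (hprod _ _ (hsin theta) h1); lra.
  - rewrite Cmod_opp; lra. }
(* The integer exponent keeps this valid at n = 0, where it is -1. *)
replace (powerRZ r (Z.of_nat n - 1)) with (r ^ n / r).
- apply Rmult_le_reg_l with r; [lra|].
  replace (r * (K * (r ^ n / r))) with (K * r ^ n) by (field; lra); exact H.
- unfold Z.sub; rewrite powerRZ_add, <- pow_powerRZ by lra.
  simpl; field; lra.
Qed.
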